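(* Let $K$ be a field of characteristic zero, and let $H=(u(x,y,z),v(x,y,z),h(x,y))$ be a polynomial map with $u,v\in K[x,y,z]$, $h\in K[x,y]$ and $\deg_z v(x,y,z)=1$. Assume that $H(0)=0$ and $\deg_z u\geq 2$. If $JH$ is nilpotent, then there exists $T\in \operatorname{GL}_3(K)$ such that $$T^{-1}HT=\big(a_2(z)f(a_1(z)x+a_2(z)y)+c_1(z),\ -a_1(z)f(a_1(z)x+a_2(z)y)+c_2(z),\ 0\big)$$ for some $a_1(z),a_2(z),c_1(z),c_2(z)\in K[z]$ and $f(t)\in K[z][t]$.
   Context: $JH$ denotes the $3\times 3$ Jacobian matrix of $H$ with respect to $(x,y,z)$, and $\deg_z$ denotes the highest degree of the variable $z$ in a polynomial. $T\in\operatorname{GL}_3(K)$ is identified with the corresponding invertible linear map $K^3\to K^3$, and $T^{-1}HT$ means the composition $T^{-1}\circ H\circ T$. For $f(t)\in K[z][t]$, $f(a_1(z)x+a_2(z)y)$ denotes the result of substituting $t=a_1(z)x+a_2(z)y$ (the coefficients of $f$ being polynomials in $z$). *)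

(* Defs.v *)
From HB Require Import structures.
From mathcomp Require Import all_boot all_order all_algebra.
From mathcomp Require Export mpoly.

Set Implicit Arguments.
Unset Strict Implicit.
Unset Printing Implicit Defensive.

Import GRing.Theory.
Local Open Scope ring_scope.

(* Polynomial maps K^n -> K^n, given by their n coordinate polynomials. Over an
   infinite field these coordinates are determined by the underlying function. *)
Definition polymap (K : fieldType) (n : nat) := n.-tuple {mpoly K[n]}.

Definition pmcomp (K : fieldType) (n : nat) (F G : polymap K n) : polymap K n :=
  [tuple tnth F i \mPo G | i < n].

(* The linear map X |-> T X, acting on column vectors. *)
Definition linmap (K : fieldType) (n : nat) (T : 'M[K]_n) : polymap K n :=
  [tuple \sum_(j < n) T i j *: 'X_j | i < n].

Definition jacobian (K : fieldType) (n : nat) (F : polymap K n) :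
    'M[{mpoly K[n]}]_n :=
  \matrix_(i, j) (tnth F i)^`M(j).

Definition nilpotent_mx (R : comNzRingType) (n : nat) (A : 'M[R]_n) : Prop :=
  exists k : nat, A ^+ k = 0.

(* Degree in the i-th variable; it is 0 on the zero polynomial. *)
Definition mdegvar (K : fieldType) (n : nat) (i : 'I_n) (p : {mpoly K[n]}) : nat :=
  (\max_(m <- msupp p) m i)%N.

(* The variables of K[x,y,z] are x = 'X_ix, y = 'X_iy and z = 'X_iz. *)
Definition ix : 'I_3 := Ordinal (isT : (0 < 3)%N).
Definition iy : 'I_3 := Ordinal (isT : (1 < 3)%N).
Definition iz : 'I_3 := Ordinal (isT : (2 < 3)%N).

Definition in_z (K : fieldType) (a : {poly K}) : {mpoly K[3]} :=
  horner_alg ('X_iz : {mpoly K[3]}) a.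

(* An element of K[z][t] is a {poly {poly K}}, with outer variable t and inner
   variable z; [subst_t f w] is the result of substituting t = w. *)
Definition subst_t (K : fieldType) (f : {poly {poly K}}) (w : {mpoly K[3]}) :
    {mpoly K[3]} :=
  (map_poly (@in_z K) f).[w].

(* Main.v *)
Require Import Defs.
From mathcomp Require Import all_boot all_order all_algebra.
From HB Require Import structures.
From mathcomp Require Import ring zify.
Set Implicit Arguments.
Unset Strict Implicit.
Unset Printing Implicit Defensive.
Import GRing.Theory.
Local Open Scope ring_scope.

(** Subscripts x, y, z are partial derivatives. A nilpotent 3 by 3 matrix over a
    domain has zero trace, zero sum of principal 2-minors and zero determinant,
    which gives three differential equations for u, v and h. The proof has two
    halves.

    The third component vanishes, so that T = 1 is a solution. Write
    v = v0 + v1 z and u as the sum of the u_i z^i, with coefficients in K[x,y],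
    and compare coefficients of powers of z; d >= 2 is the z-degree of u.
    - Suppose that v1 depends on x. The top coefficients force the Jacobian
      brackets of h with v0, v1 and every u_i to vanish. The equation for the
      2-minors then becomes u_z h_x + v_z h_y = 0, up to a factor h_x or h_y; its
      coefficient at z^(d-1) gives h_x = 0, and then v1 h_y = 0.
    - Suppose that v1 is free of x. If h_x = 0 and h_y <> 0, the equations
      collapse to v1 v1'' = 2 v1'^2, which has no nonconstant polynomial solution,
      and constant v1 is impossible. If h_x <> 0, a comparison of y-degrees makes
      v1 constant; then the gradient of h is an explicit combination of that of
      v0, and substituting it in the two equations at z^0 gives a contradiction.
    This is [third_gradient_eq0], and h = 0 follows since h vanishes at 0.

    The remaining map (u, v) is a planar map over K[z] whose Jacobian matrix has
    zero trace and zero determinant. If u_y <> 0, the quotient r = u_x / u_y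
    satisfies the Burgers equation r_x = r r_y. A rational solution is either
    constant or of the form (y + c) / (e - x). In the second case u would be
    constant on the lines through a point, and Euler's relation makes a polynomial
    with this property constant ([constant_slope]). So a2 u_x = a1 u_y with coprime
    a1, a2 in K[z], and the same relation holds for v: both are functions of
    w = a1 x + a2 y. Moreover a1 u + a2 v = e depends on z only. With
    s a1 + t a2 = 1, the choice f = t u - s v, as a polynomial in w, satisfies
    u = a2 f + s e and v = - a1 f + t e. *)

(** * Linear combinations of equations *)


Section LinearCombination.
Variable R : comNzRingType.
Implicit Types a b c p q : R.

Lemma scale_eqn c a b : a = b -> c * (a - b) = 0.
Proof. by move=> ->; rewrite subrr mulr0. Qed.

Lemma add_eqn p q : p = 0 -> q = 0 -> p + q = 0.
Proof. by move=> -> ->; rewrite addr0. Qed.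

Lemma eq_of_combination a b p : p = 0 -> a - b = p -> a = b.
Proof. by move=> -> /subr0_eq. Qed.

End LinearCombination.

(** Ideal membership with explicit cofactors: [e] is a combination of equations that
    hold, and what remains is the ring identity saying that it equals the
    difference of the two sides of the goal. *)
Ltac combine e := apply: (eq_of_combination e); ring.

(** * Polynomials in characteristic zero *)

Lemma affine_of_size (R : nzRingType) (p : {poly R}) :
  (size p <= 2)%N -> p = (p`_0)%:P + (p`_1)%:P * 'X.
Proof.
move=> le2; apply/polyP => [] [|[|i]];
  rewrite coefD coefC coefCM coefX /= ?mulr0 ?mulr1 ?addr0 ?add0r //.
by rewrite nth_default // (leq_trans le2).
Qed.

Lemma coefM_affine (R : comNzRingType) (p : {poly R}) a b i :
  (p * (a%:P + b%:P * 'X))`_i = p`_i * a + (if i is j.+1 then p`_j * b else 0).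
Proof.
rewrite mulrDr coefD coefMC mulrA coefMX; case: i => [|i] //=.
by rewrite coefMC.
Qed.

Section CharZero.
Variable R : idomainType.
Hypothesis char0 : [pchar R] =i pred0.

Lemma mulrSn_eq0 (x : R) n : (x *+ n.+1 == 0) = (x == 0).
Proof. by rewrite -mulr_natr mulf_eq0 ((pcharf0P R).1 char0) orbF. Qed.

Lemma mulrn_injr (x : R) m n : x != 0 -> x *+ m = x *+ n -> m = n.
Proof.
move=> x_neq0; wlog le_mn : m n / (m <= n)%N.
  by move=> wl; case/orP: (leq_total m n) => [/wl//|/wl wl' /esym /wl'].
rewrite -(subnKC le_mn) mulrnDr -{1}[x *+ m]addr0 => /addrI/esym/eqP.
by case: (n - m)%N => [|j]; rewrite ?addn0 // mulrSn_eq0 // (negPf x_neq0).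
Qed.

Lemma pchar0_poly : [pchar {poly R}] =i pred0.
Proof. by move=> p; rewrite pchar_poly char0. Qed.

Lemma size_deriv_char0 (p : {poly R}) : size p^`() = (size p).-1.
Proof.
have [le1 | gt1] := leqP (size p) 1.
  by rewrite (size1_polyC le1) derivC size_poly0 size_polyC; case: eqP.
apply/eqP; rewrite eqn_leq; apply/andP; split.
  by rewrite -ltnS (ltn_predK gt1) lt_size_deriv // -size_poly_gt0 ltnW.
case def_n: (size p) gt1 (lead_coefE p) => [|[|n]] //= _ lcE.
rewrite ltnNge; apply/negP => /leq_sizeP/(_ n (leqnn _)); rewrite coef_deriv.
move/eqP; rewrite mulrSn_eq0 -lcE lead_coef_eq0 => /eqP p0.
by move: def_n; rewrite p0 size_poly0.
Qed.

Lemma deriv_eq0 (p : {poly R}) : (p^`() == 0) = (size p <= 1)%N.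
Proof.
by rewrite -size_poly_eq0 size_deriv_char0; case: (size (polyseq p)) => [|[|n]].
Qed.

Lemma lead_coef_deriv_char0 (p : {poly R}) :
  lead_coef p^`() = lead_coef p *+ (size p).-1.
Proof.
rewrite !lead_coefE size_deriv_char0 coef_deriv.
have [le1 | gt1] := leqP (size p) 1; last by case: (size p) gt1 => [|[|n]].
by rewrite (nth_default 0 (leq_trans le1 _)) // mul0rn;
  case: (size p) le1 => [|[|n]].
Qed.

(** The equation says that the second derivative of 1/p is zero. With m the degree
    of p, the leading coefficients give m (m - 1) = 2 m^2, so m = 0. *)
Lemma deriv_eq0_of_riccati (p : {poly R}) :
  p * p^`()^`() = p^`() * p^`() *+ 2 -> p^`() = 0.
Proof.
move=> riccati; apply/eqP; rewrite deriv_eq0 leqNgt; apply/negP => p_gt1.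
have lead_neq0 : lead_coef p != 0.
  by rewrite lead_coef_eq0 -size_poly_gt0 ltnW.
have := congr1 lead_coef riccati.
rewrite -scaler_nat lead_coefZ !lead_coefM !lead_coef_deriv_char0 size_deriv_char0.
case: (size p) p_gt1 => [|[|m]] //= _ lead_riccati.
have : lead_coef p * lead_coef p *+ (m.+1 * m.+2) = 0.
  by rewrite mulnC; combine (scale_eqn (-1) lead_riccati).
by move/eqP; rewrite -[(_ * _)%N]prednK // mulrSn_eq0 // mulf_eq0 orbb (negPf lead_neq0).
Qed.

End CharZero.

(** * Vanishing of the third component *)

(** The coefficients of the powers of z live in [{poly A}], where A is K[x], the
    outer variable is y and [dx] is differentiation in x. Here [u i] is the
    coefficient of z^i in u, which has degree k + 2 in z, and v = v0 + v1 z. The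
    hypotheses [trace], [minors] and [det] are the coefficients of powers of z in
    the equations that express nilpotency of the Jacobian matrix. *)
Section ThirdComponentVanishes.
Variables (A : idomainType) (dx : {additive {poly A} -> {poly A}}).
Hypothesis char0 : [pchar A] =i pred0.
Hypothesis dxM : forall p q, dx (p * q) = dx p * q + p * dx q.
Hypothesis dx_deriv : forall p, dx p^`() = (dx p)^`().

Variables (u : nat -> {poly A}) (k : nat) (v0 v1 h : {poly A}).
Local Notation e := (u k.+2 *+ k.+2).
Hypothesis u_top : u k.+2 != 0.
Hypothesis u_above : forall i, (k.+2 < i)%N -> u i = 0.
Hypothesis v1_neq0 : v1 != 0.

Hypothesis trace0 : dx (u 0) = - v0^`().
Hypothesis trace1 : dx (u 1) = - v1^`().
Hypothesis traceSS : forall i, dx (u i.+2) = 0.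
Hypothesis minors0 :
  dx (u 0) * v0^`() - (u 0)^`() * dx v0 - u 1 * dx h - v1 * h^`() = 0.
Hypothesis minorsS : forall i,
  dx (u i.+1) * v0^`() + dx (u i) * v1^`() - (u i.+1)^`() * dx v0
    - (u i)^`() * dx v1 - u i.+2 *+ i.+2 * dx h = 0.
Hypothesis det : forall i,
  dx h * ((u i)^`() * v1 - u i.+1 *+ i.+1 * v0^`() - u i *+ i * v1^`())
    - h^`() * (dx (u i) * v1 - u i.+1 *+ i.+1 * dx v0 - u i *+ i * dx v1) = 0.

Let char0B : [pchar {poly A}] =i pred0. Proof. exact: pchar0_poly. Qed.

Let e_neq0 : e != 0. Proof. by rewrite mulrSn_eq0. Qed.

Let u_above1 : u k.+3 = 0. Proof. exact: u_above. Qed.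
Let u_above2 : u k.+4 = 0. Proof. exact: u_above. Qed.

(** All brackets with h vanish, one after the other: with v1 from [det] in degree
    k + 2, with [u k.+1] from [minors] in the same degree, with v0 from [det] in
    degree k + 1, and with all [u i] from the rest of [det]. Multiplying [minors]
    by h_x or h_y then cancels everything but one term. *)
Lemma third_gradient_eq0_of_v1x_neq0 : dx v1 != 0 -> dx h = 0 /\ h^`() = 0.
Proof.
move=> v1x.
have uy_top : (u k.+2)^`() = 0.
  apply: (mulIf v1x); have := minorsS k.+2.
  rewrite u_above1 u_above2 !traceSS deriv0 => m.
  by combine (scale_eqn (-1) m).
have hv1 : dx h * v1^`() = h^`() * dx v1.
  apply: (mulfI e_neq0); have := det k.+2.
  rewrite u_above1 traceSS uy_top => m.
  by combine (scale_eqn (-1) m).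
(* For k = 0 this uses v1_y^2 + u1_y v1_x = 0; otherwise u_{k+1} is constant. *)
have hu_next : dx h * (u k.+1)^`() = h^`() * dx (u k.+1).
  have := minorsS k.+1; rewrite traceSS uy_top u_above1 => m.
  case: k m => [|k'] m.
    rewrite trace1 in m *.
    apply: (mulIf v1x).
    combine (add_eqn (scale_eqn (- dx h) m) (scale_eqn (- v1^`()) hv1)).
  rewrite traceSS in m *.
  have -> : (u k'.+2)^`() = 0; last by rewrite !mulr0.
  by apply: (mulIf v1x); combine (scale_eqn (-1) m).
have hv0 : dx h * v0^`() = h^`() * dx v0.
  apply: (mulfI e_neq0).
  combine (add_eqn (scale_eqn (-1) (det k.+1))
            (add_eqn (scale_eqn v1 hu_next) (scale_eqn (- (u k.+1 *+ k.+1)) hv1))).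
have hu i : dx h * (u i)^`() = h^`() * dx (u i).
  apply: (mulIf v1_neq0).
  combine (add_eqn (scale_eqn 1 (det i))
       (add_eqn (scale_eqn (u i.+1 *+ i.+1) hv0) (scale_eqn (u i *+ i) hv1))).
have hx : dx h = 0.
  have sq : e * (dx h * dx h) = 0.
    combine (add_eqn (scale_eqn (- dx h) (minorsS k))
       (add_eqn (add_eqn (scale_eqn (dx (u k.+1)) hv0) (scale_eqn (- dx v0) (hu k.+1)))
          (add_eqn (scale_eqn (dx (u k)) hv1) (scale_eqn (- dx v1) (hu k))))).
  by move/eqP: sq; rewrite mulf_eq0 (negPf e_neq0) mulf_eq0 orbb => /eqP.
split=> //.
have sq : v1 * (h^`() * h^`()) = 0.
  combine (add_eqn (scale_eqn (- h^`()) minors0)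
     (add_eqn (add_eqn (scale_eqn (- v0^`()) (hu 0)) (scale_eqn ((u 0)^`()) hv0))
              (scale_eqn (v0^`() * (u 0)^`() - (u 0)^`() * v0^`() - u 1 * h^`()) hx))).
by move/eqP: sq; rewrite mulf_eq0 (negPf v1_neq0) mulf_eq0 orbb => /eqP.
Qed.

(** When h depends on y only, [det] reads u_x v1 = u_z v_x coefficientwise. As u_x has
    degree at most 1 in z and v0_x <> 0, this forces k = 0 and expresses v0_x through v1 and
    [u 2]; eliminating both leaves the Riccati type equation for v1. *)
Lemma third_y_eq0_of_v1x_eq0 : dx v1 = 0 -> dx h = 0 -> h^`() = 0.
Proof.
move=> v1x hx; have [// | hy] := eqVneq h^`() 0.
have ux i : dx (u i) * v1 = u i.+1 *+ i.+1 * dx v0.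
  apply: (mulfI hy).
  combine (add_eqn (scale_eqn (-1) (det i))
     (add_eqn (scale_eqn ((u i)^`() * v1 - u i.+1 *+ i.+1 * v0^`() - u i *+ i * v1^`()) hx)
              (scale_eqn (h^`() * (u i *+ i)) v1x))).
have v0x : dx v0 != 0.
  apply: contra_neq hy => v0x.
  have u0x : dx (u 0) = 0.
    by apply: (mulIf v1_neq0); rewrite ux v0x mulr0 mul0r.
  apply: (mulfI v1_neq0).
  combine (add_eqn (scale_eqn (-1) minors0)
     (add_eqn (add_eqn (scale_eqn v0^`() u0x) (scale_eqn (- (u 0)^`()) v0x))
              (scale_eqn (- u 1) hx))).
have k0 : k = 0%N.
  case: k (ux k.+1) e_neq0 => // k'; rewrite traceSS mul0r => /esym/eqP.
  by rewrite mulf_eq0 (negPf v0x) orbF => ->.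
have u3 : u 3 = 0 by rewrite -k0 u_above1.
have u2 : u 2 != 0 by have := u_top; rewrite k0.
have u2v0x : u 2 *+ 2 * dx v0 = - v1^`() * v1 by rewrite -trace1 ux.
have v0xx : dx (dx v0) = 0.
  have := congr1 dx u2v0x.
  rewrite !dxM raddfMn raddfN /= traceSS dx_deriv v1x deriv0 mulr0 mul0rn.
  rewrite mul0r oppr0 mul0r !addr0 add0r => /eqP.
  by rewrite mulf_eq0 mulrSn_eq0 // (negPf u2) => /eqP.
(* v0_x and v1 are proportional as functions of y. *)
have v0xy : (dx v0)^`() * v1 = v1^`() * dx v0.
  have := congr1 dx (ux 0); rewrite mulr1n !dxM v1x v0xx trace1 trace0 => ddx.
  have /= ddx0 : dx (- v0^`()) = - (dx v0)^`() by rewrite raddfN /= dx_deriv.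
  by rewrite ddx0 in ddx; combine (scale_eqn (-1) ddx).
have v1y2 : v1^`() * v1^`() = - (u 2)^`() * dx v0.
  have := minorsS 1; rewrite traceSS trace1 u3 v1x => m.
  by combine (scale_eqn (-1) m).
have riccati : v1 * v1^`()^`() = v1^`() * v1^`() *+ 2.
  apply: (mulIf v1_neq0).
  have := congr1 (@deriv A) u2v0x; rewrite !derivM derivMn derivN => d2.
  combine (add_eqn (scale_eqn v1 d2)
     (add_eqn (add_eqn (scale_eqn (- u 2 *+ 2) v0xy) (scale_eqn (- v1^`()) u2v0x))
              (scale_eqn (- v1 *+ 2) v1y2))).
have v1y := deriv_eq0_of_riccati char0 riccati.
move: u2v0x; rewrite v1y oppr0 mul0r => /eqP.
by rewrite mulf_eq0 mulrSn_eq0 // (negPf u2) (negPf v0x).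
Qed.

(** With v1 constant, [minors] and [det] just below the top degree give
    h_x = (p/e) v0_x and h_y = (p/e) v0_y + (p/e)^2 v1, where e is k + 2 times the
    leading coefficient of u and p = - (u_{k+1})_y. Substituting these in the
    equations at z^0 turns the second one into (p/e) v1 times an expression from which
    the first one differs by (p/e)^2 v1^2 only, so p = 0. *)
Lemma third_x_eq0_of_v1_const : dx v1 = 0 -> v1^`() = 0 -> dx h = 0.
Proof.
move=> v1x v1y; apply/eqP; apply/negPn/negP => hx.
have uSx i : dx (u i.+1) = 0.
  by case: i => [|i]; rewrite ?traceSS // trace1 v1y oppr0.
have hx_v0x : e * dx h = - (u k.+1)^`() * dx v0.
  have := minorsS k; rewrite uSx v1x v1y => m.
  by combine (scale_eqn (-1) m).
have v0x : dx v0 != 0.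
  apply: contra_neq hx => v0x; apply: (mulfI e_neq0).
  by rewrite hx_v0x v0x !mulr0.
set p := - (u k.+1)^`() in hx_v0x.
have hy_v0y : e * e * h^`() = p * p * v1 + e * p * v0^`().
  apply: (mulIf v0x).
  have := det k.+1; rewrite uSx v1x v1y => m.
  rewrite /p in hx_v0x *.
  combine (add_eqn (scale_eqn e m)
    (scale_eqn (e * v0^`() - (u k.+1)^`() * v1) hx_v0x)).
(* The combination p v1 e^2 minors0 + e^3 det0, reduced by the formulas for h_x, h_y. *)
have : p * p * p * v1 * v1 * v1 = 0.
  combine (add_eqn
    (add_eqn (scale_eqn (- p * v1 * e * e) minors0) (scale_eqn (- e * e * e) (det 0)))
    (add_eqn
      (add_eqn
        (scale_eqn (e * e * ((u 0)^`() * v1 - u 1 * v0^`()) - p * v1 * e * u 1) hx_v0x)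
        (scale_eqn (- (p * v1 * v1 + e * (dx (u 0) * v1 - u 1 * dx v0))) hy_v0y))
      (scale_eqn (- e * p * p * v1 * v1) trace0))).
move/eqP; rewrite !mulf_eq0 (negPf v1_neq0) !orbF !orbb => /eqP p0.
by move/eqP: hx_v0x; rewrite p0 mul0r mulf_eq0 (negPf e_neq0) (negPf hx).
Qed.

(** If v1 is not constant and h_x <> 0, [det] in top degree says that the top
    coefficient of u has y-degree (k + 2) m, where m >= 1 is that of v1. But v1_y^2,
    of degree 2m - 2, is a nonzero multiple of (u_2)_y if k = 0, and of u_3 if k = 1,
    whose degrees are larger; for k >= 2, [minors] gives h_x = 0. *)
Lemma third_x_eq0_of_v1x_eq0 : dx v1 = 0 -> dx h = 0.
Proof.
move=> v1x; have [/third_x_eq0_of_v1_const -> // | v1y] := eqVneq v1^`() 0.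
apply/eqP; apply/negPn/negP => hx.
have uy_top : (u k.+2)^`() * v1 = e * v1^`().
  apply: (mulfI hx); have := det k.+2; rewrite u_above1 traceSS v1x => m.
  by combine (scale_eqn 1 m).
have v1_gt1 : (1 < size v1)%N by rewrite ltnNge -(deriv_eq0 char0).
have deg_top : (size (u k.+2)).-1 = (k.+2 * (size v1).-1)%N.
  have := congr1 lead_coef uy_top.
  rewrite -scaler_nat -scalerAl lead_coefZ !lead_coefM !(lead_coef_deriv_char0 char0).
  move=> lead; apply: (@mulrn_injr _ char0 (lead_coef (u k.+2) * lead_coef v1)).
    by rewrite mulf_neq0 ?lead_coef_eq0.
  by rewrite mulrnAl in lead; rewrite {}lead mulnC; ring.
have uy_top_neq0 : (u k.+2)^`() != 0.
  by rewrite deriv_eq0 // -ltnNge; move: deg_top v1_gt1; nia.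
have v1y2_neq0 : - (v1^`() * v1^`()) != 0 by rewrite oppr_eq0 mulf_neq0.
have size_v1y2 : (size (- (v1^`() * v1^`()))).+1 = ((size v1).-1 + (size v1).-1)%N.
  rewrite size_polyN size_mul // !size_deriv_char0 // prednK //.
  by case: (size v1) v1_gt1 => [|[|]].
case: k deg_top uy_top_neq0 e_neq0 (minorsS k) (minorsS k.+1) u_above1 => [|k'].
  move=> deg2 u2y _ _ m u3; rewrite u3 traceSS trace1 v1x in m.
  have eq2 : - (v1^`() * v1^`()) = (u 2)^`() * dx v0 by combine (scale_eqn 1 m).
  have v0x : dx v0 != 0 by apply: contra_neq v1y2_neq0; rewrite eq2 => ->; rewrite mulr0.
  move: size_v1y2; rewrite eq2 size_mul // size_deriv_char0 // deg2.
  by move: v1_gt1; rewrite -size_poly_gt0 in v0x; move: v0x; lia.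
rewrite !traceSS => deg3 u3y e3 m m'.
move=> above; rewrite v1x mul0r add0r above in m'.
have v0x : dx v0 = 0 by apply: (mulfI u3y); combine (scale_eqn (-1) m').
case: k' deg3 u3y e3 m {m' above} => [|k'] deg3 u3y e3;
  rewrite ?traceSS ?trace1 v1x v0x => m; last first.
  have /eqP : u k'.+4 *+ k'.+4 * dx h = 0 by combine (scale_eqn (-1) m).
  by rewrite mulf_eq0 (negPf e3) (negPf hx).
have eq3 : - (v1^`() * v1^`()) = u 3 *+ 3 * dx h by combine (scale_eqn 1 m).
move: size_v1y2; rewrite eq3 size_mul //.
rewrite -scaler_nat size_scale; last by rewrite ((pcharf0P A).1 char0).
move: deg3 v1_gt1; rewrite -size_poly_gt0 in hx; move: hx; lia.
Qed.

Lemma third_gradient_eq0 : dx h = 0 /\ h^`() = 0.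
Proof.
have [v1x | /third_gradient_eq0_of_v1x_neq0 //] := eqVneq (dx v1) 0.
have hx := third_x_eq0_of_v1x_eq0 v1x.
by split; last exact: third_y_eq0_of_v1x_eq0.
Qed.

End ThirdComponentVanishes.

(** The same result for polynomials U and V in z, with the equations not yet
    separated into their coefficients. *)
Lemma third_gradient_eq0_poly (A : idomainType)
    (dx : {additive {poly A} -> {poly A}})
    (U V : {poly {poly A}}) (h : {poly A})
    (dX := map_poly dx) (dY := map_poly (@deriv A)) :
    [pchar A] =i pred0 ->
    (forall p q, dx (p * q) = dx p * q + p * dx q) ->
    (forall p, dx p^`() = (dx p)^`()) ->
    (2 < size U)%N -> size V = 2%N ->
    dX U + dY V = 0 ->
    dX U * dY V - dY U * dX V - U^`() * (dx h)%:P - V^`() * (h^`())%:P = 0 ->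
    (dx h)%:P * (dY U * V^`() - U^`() * dY V)
      - (h^`())%:P * (dX U * V^`() - U^`() * dX V) = 0 ->
  dx h = 0 /\ h^`() = 0.
Proof.
move=> char0 dxM dx_deriv U_gt2 size_V tr mi de.
have [k def_k] : exists k, size U = k.+3.
  by case: (size U) U_gt2 => [|[|[|k]]] // _; exists k.
have def_V := affine_of_size (eq_leq size_V).
have size_map (D : {poly A} -> {poly A}) : (size (map_poly D V) <= 2)%N.
  by rewrite -size_V size_poly.
have defX : dX V = (dx V`_0)%:P + (dx V`_1)%:P * 'X.
  by rewrite [LHS](affine_of_size (size_map dx)) !coef_map.
have defY : dY V = ((V`_0)^`())%:P + ((V`_1)^`())%:P * 'X.
  by rewrite [LHS](affine_of_size (size_map (@deriv A))) !coef_map.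
have defZ : V^`() = (V`_1)%:P.
  by rewrite {1}def_V derivD derivM !derivC derivX mul0r !add0r mulr1.
have tri i : dx U`_i = - (V`_i)^`().
  by apply/eqP; rewrite -addr_eq0 -[_^`()](coef_map (@deriv A)) -coef_map -coefD tr coef0.
have V_above i : V`_i.+2 = 0 by rewrite nth_default // size_V.
rewrite defZ in mi de.
apply: (@third_gradient_eq0 _ dx char0 dxM dx_deriv (fun i => U`_i) k V`_0 V`_1 h) => //=.
- have := lead_coef_eq0 U; rewrite lead_coefE def_k /= => ->.
  by rewrite -size_poly_eq0 def_k.
- by move=> i lt_ki; rewrite nth_default // def_k.
- have := lead_coef_eq0 V; rewrite lead_coefE size_V /= => ->.
  by rewrite -size_poly_eq0 size_V.
- by move=> i; rewrite tri V_above deriv0 oppr0.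
- have := congr1 (fun p : {poly {poly A}} => p`_0) mi.
  rewrite !(coefB, coef0) defX defY !coefM_affine !coefMC coef_deriv coefC !coef_map /=.
  move=> m.
  by combine (scale_eqn 1 m).
- move=> i; have := congr1 (fun p : {poly {poly A}} => p`_i.+1) mi.
  rewrite !(coefB, coef0) defX defY !coefM_affine !coefMC coef_deriv coefC !coef_map /=.
  move=> m.
  by combine (scale_eqn 1 m).
move=> i; have := congr1 (fun p : {poly {poly A}} => p`_i) de.
rewrite coefB !coefCM !coefB !coefMC defX defY !coefM_affine coef0.
rewrite !coef_deriv !coef_map /=; case: i => [|i] m.
  by combine (scale_eqn 1 m).
by rewrite coef_deriv in m; combine (scale_eqn 1 m).
Qed.

(** * Derivations acting on coefficients *)

Section CoefficientwiseDerivation.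
Variables (R : comNzRingType) (D : {additive R -> R}).
Hypothesis DM : forall a b, D (a * b) = D a * b + a * D b.

Lemma derivation1 : D 1 = 0.
Proof. by have /eqP := DM 1 1; rewrite !mulr1 mul1r -subr_eq subrr eq_sym => /eqP. Qed.

Lemma map_polyM_derivation p q :
  map_poly D (p * q) = map_poly D p * q + p * map_poly D q.
Proof.
apply/polyP=> i; rewrite coefD !coefM coef_map coefM raddf_sum -big_split.
by apply: eq_bigr => j _; rewrite /= DM !coef_map.
Qed.

Lemma map_polyX_derivation : map_poly D 'X = 0.
Proof.
by apply/polyP=> i; rewrite coef_map coefX coef0; case: eqP; rewrite ?derivation1 ?raddf0.
Qed.

Lemma map_poly_derivation_deriv p : map_poly D p^`() = (map_poly D p)^`().
Proof. by apply/polyP=> i; rewrite coef_map !coef_deriv coef_map raddfMn. Qed.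

End CoefficientwiseDerivation.

(** * Planar maps with trace and determinant zero *)

(** The plane has coordinates x and y over A: in [{poly {poly A}}] the inner variable
    is x and the outer one is y. *)
Section ConstantSlope.
Variable A : idomainType.
Hypothesis char0 : [pchar A] =i pred0.

(** The leading coefficients of both sides differ by the factors deg f and deg g. *)
Lemma size_eq_of_wronskian (f g : {poly A}) :
  f != 0 -> g != 0 -> f^`() * g = f * g^`() -> size f = size g.
Proof.
move=> f_neq0 g_neq0 /(congr1 lead_coef).
rewrite !lead_coefM !(lead_coef_deriv_char0 char0) mulrnAl mulrnAr.
rewrite -size_poly_gt0 in f_neq0; rewrite -size_poly_gt0 in g_neq0.
move/(mulrn_injr char0) => eq_deg.
rewrite -(prednK f_neq0) -(prednK g_neq0) eq_deg //.
by rewrite mulf_neq0 // lead_coef_eq0 -size_poly_gt0.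
Qed.

(** The combination of f and g that cancels the leading terms has the same vanishing
    Wronskian with g but a smaller size, so it is zero. *)
Lemma proportional_of_wronskian (f g : {poly A}) :
  g != 0 -> f^`() * g = f * g^`() -> lead_coef g *: f = lead_coef f *: g.
Proof.
move=> g_neq0 wr; have [->|f_neq0] := eqVneq f 0.
  by rewrite lead_coef0 scaler0 scale0r.
have eq_size := size_eq_of_wronskian f_neq0 g_neq0 wr.
apply/eqP; rewrite -subr_eq0; apply/negPn/negP => w_neq0.
have := size_eq_of_wronskian w_neq0 g_neq0.
set w := (X in X != 0) in w_neq0 *.
have wr' : w^`() * g = w * g^`().
  by rewrite /w derivB !derivZ !mulrBl -!scalerAl wr [g^`() * g]mulrC.
move=> /(_ wr') size_w.
have : w`_(size g).-1 = 0.
  by rewrite coefB !coefZ -eq_size -lead_coefE eq_size -lead_coefE mulrC subrr.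
by move/eqP; rewrite -size_w -lead_coefE lead_coef_eq0 (negPf w_neq0).
Qed.

Local Notation dx := (map_poly (@deriv A)).
Local Notation dy := (@deriv {poly A}).

Let dxM (p q : {poly {poly A}}) : dx (p * q) = dx p * q + p * dx q.
Proof. exact: (map_polyM_derivation (@derivM A)). Qed.

(** With r = a / b this is r_x = r r_y with denominators cleared. It is the equality
    of the mixed derivatives of Q, since Q_y = - r b and Q_x = - r^2 b. *)
Lemma burgers (P Q : {poly {poly A}}) (a := dx P) (b := dy P) :
    dx P = - dy Q -> dx P * dy Q = dy P * dx Q ->
  b * (dx a * b - a * dx b) = a * (dy a * b - a * dy b).
Proof.
move=> tr0 det0.
have dxy p : dx (dy p) = dy (dx p) by exact: map_poly_derivation_deriv.
have Qx : b * dx Q = - (a * a).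
  by rewrite -det0 -[dy Q]opprK -tr0 mulrN.
have ay : dy a = dx b by rewrite dxy.
have Qxy : dy (dx Q) = - dx a.
  by rewrite -dxy -[dy Q]opprK -tr0 raddfN.
have d := congr1 dy Qx; rewrite !(derivM, derivN) Qxy in d.
combine (add_eqn (scale_eqn (- b) d)
   (add_eqn (scale_eqn (dy b) Qx) (scale_eqn (a * b) ay))).
Qed.

(** The equation depends on a / b only, so it passes to a reduced fraction p / q. *)
Lemma burgers_of_quotient (a b p q : {poly {poly A}}) :
    q * a = p * b -> b != 0 ->
    b * (dx a * b - a * dx b) = a * (dy a * b - a * dy b) ->
  q * (dx p * q - p * dx q) = p * (dy p * q - p * dy q).
Proof.
move=> qa b_neq0 eqn.
apply: (mulfI b_neq0); apply: (mulfI b_neq0); apply: (mulfI b_neq0).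
have qax := congr1 dx qa; have qay := congr1 dy qa.
rewrite !dxM in qax; rewrite !derivM in qay.
combine (add_eqn
   (add_eqn (scale_eqn (q * q * q) eqn)
     (add_eqn (scale_eqn (- (b * b * q * q)) qax) (scale_eqn (b * b * p * q) qay)))
   (scale_eqn (q * q * (dy a * b - a * dy b) + b * q * (q * dx b + b * dx q)
               - b * p * (q * dy b + b * dy q)) qa)).
Qed.

(** A denominator q coprime to p divides p^2 q_y, hence q_y, and so it is free of y.
    After that, the y-degree k of p satisfies 2k - 1 <= k. *)
Lemma burgers_coprime (p q : {poly {poly A}}) :
    q != 0 -> coprimep p q ->
    q * (dx p * q - p * dx q) = p * (dy p * q - p * dy q) ->
  exists q0 p0 p1 : {poly A}, [/\ q = q0%:P, p = p0%:P + p1%:P * 'X,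
     p0^`() * q0 - p0 * q0^`() = p0 * p1 & p1^`() * q0 - p1 * q0^`() = p1 * p1].
Proof.
move=> q_neq0 co_pq eqn.
have qy : dy q = 0.
  apply/eqP; apply/negPn/negP => qy_neq0.
  have /dvdp_leq : q %| dy q.
    rewrite -(@Gauss_dvdpr _ _ p) 1?coprimep_sym // -(@Gauss_dvdpr _ _ p) 1?coprimep_sym //.
    have -> : p * (p * dy q) = q * (p * dy p - dx p * q + p * dx q).
      by combine (scale_eqn 1 eqn).
    exact/dvdp_mulr/dvdpp.
  by rewrite qy_neq0 leqNgt lt_size_deriv // => /(_ isT).
have eqn1 : dx p * q - p * dx q = p * dy p.
  by apply: (mulfI q_neq0); combine (add_eqn (scale_eqn 1 eqn) (scale_eqn (- p * p) qy)).
have /size1_polyC def_q : (size q <= 1)%N.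
  by rewrite -(deriv_eq0 (pchar0_poly char0)) qy.
set q0 := q`_0 in def_q; rewrite def_q map_polyC /= in eqn1.
have size_p : (size p <= 2)%N.
  rewrite leqNgt; apply/negP => p_gt2.
  have dyp_neq0 : dy p != 0.
    by rewrite (deriv_eq0 (pchar0_poly char0)) -ltnNge ltnW.
  have p_neq0 : p != 0 by rewrite -size_poly_gt0 ltnW // ltnW.
  have : (size (dx p * q0%:P - p * (q0^`())%:P)%R <= size p)%N.
    rewrite (leq_trans (size_polyD _ _)) // geq_max size_polyN ![_ * _%:P]mulrC !mul_polyC.
    by rewrite !(leq_trans (size_scale_leq _ _)) // size_poly.
  rewrite eqn1 size_mul // (size_deriv_char0 (pchar0_poly char0)).
  by move: p_gt2; case: (size p) => [|[|[|n]]] //= _; lia.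
have def_p := affine_of_size size_p.
exists q0, p`_0, p`_1; split=> //.
  have := congr1 (fun r : {poly {poly A}} => r`_0) eqn1.
  rewrite {4}def_p derivD derivM !derivC derivX mul0r !add0r mulr1.
  by rewrite coefB !coefMC coef_map.
have := congr1 (fun r : {poly {poly A}} => r`_1) eqn1.
rewrite {4}def_p derivD derivM !derivC derivX mul0r !add0r mulr1.
by rewrite coefB !coefMC coef_map.
Qed.

(** The hypothesis says that P is constant on the lines through the point
    (a/b, - c/b). If P has degree k in y and the coefficient of y^k has degree n in
    x, the coefficient of x^n y^k in the equation gives - b n = b k. *)
Lemma deriv_eq0_of_radial (P : {poly {poly A}}) (a b c : A) :
    b != 0 -> (a%:P - b%:P * 'X)%:P * dx P = (c%:P%:P + b%:P%:P * 'X) * dy P ->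
  dy P = 0.
Proof.
move=> b_neq0 euler; apply/eqP; rewrite (deriv_eq0 (pchar0_poly char0)) leqNgt.
apply/negP => P_gt1; set f := lead_coef P.
have f_neq0 : f != 0 by rewrite lead_coef_eq0 -size_poly_gt0 ltnW.
have top_y : (a%:P - b%:P * 'X) * f^`() = b%:P * f *+ (size P).-1.
  have := congr1 (fun r : {poly {poly A}} => r`_(size P).-1) euler.
  rewrite coefCM coef_map /= -lead_coefE => ->.
  rewrite mulrDl coefD -mulrA !coefCM coefXM !coef_deriv.
  case def_n: (size P) P_gt1 (lead_coefE P) => [|[|n]] //= _ lcE.
  rewrite (@nth_default _ 0 P n.+2) ?def_n // mul0rn mulr0 add0r.
  by rewrite /f lcE mulrnAr.
have := congr1 (fun r : {poly A} => r`_(size f).-1) top_y.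
rewrite mulrBl coefB -mulrA !coefCM coefXM coefMn coefCM coef_deriv.
have -> : f`_(size f).-1.+1 = 0 by rewrite nth_default // leqSpred.
rewrite mul0rn mulr0 sub0r -lead_coefE.
have -> : (if (size f).-1 == 0%N then 0 else f^`()`_(size f).-1.-1) =
          lead_coef f *+ (size f).-1.
  rewrite lead_coefE; case: ((size f).-1) => [|n] //=.
  by rewrite coef_deriv.
move=> eq_lead; have : b * lead_coef f *+ ((size P).-1 + (size f).-1) = 0.
  by combine (scale_eqn (-1) eq_lead).
move/eqP; rewrite -[((size P).-1 + _)%N]prednK; last first.
  by rewrite addn_gt0; case: (size P) P_gt1 => [|[|]].
by rewrite (mulrSn_eq0 char0) mulf_eq0 (negPf b_neq0) lead_coef_eq0 (negPf f_neq0).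
Qed.

(** The two equations of [burgers_coprime] say that the Wronskians of p0 and of
    q0 + x p1 with p1 vanish when p1 <> 0. So p0 and q0 + x p1 are constant multiples
    of p1, and the slope is (y + c) / (a - x) up to constants: that is the radial
    case. *)
Lemma constant_slope (P Q : {poly {poly A}}) :
    dx P = - dy Q -> dx P * dy Q = dy P * dx Q -> dy P != 0 ->
  exists2 a : A, a != 0 & exists b : A, a%:P%:P * dx P = b%:P%:P * dy P.
Proof.
move=> tr0 det0 b_neq0.
have [p [q [q_neq0 co_pq qa]]] :
    exists p q : {poly {poly A}}, [/\ q != 0, coprimep p q & q * dx P = p * dy P].
  set g := gcdp (dx P) (dy P).
  have g_neq0 : g != 0 by rewrite gcdp_eq0 negb_and b_neq0 orbT.
  have := Pdiv.Idomain.divpK (dvdp_gcdl (dx P) (dy P)).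
  have := Pdiv.Idomain.divpK (dvdp_gcdr (dx P) (dy P)).
  rewrite -/g; set d := _ ^+ _ => eq_d; set c := _ ^+ _ => eq_c.
  have d_neq0 : d != 0 by rewrite expf_neq0 ?lead_coef_eq0.
  have c_neq0 : c != 0 by rewrite expf_neq0 ?lead_coef_eq0.
  (* Over a domain, division by g is exact only up to the scalars c and d. *)
  exists (d *: (dx P %/ g)), (c *: (dy P %/ g)); split.
  - rewrite scale_poly_eq0 negb_or c_neq0; apply: contra_neq b_neq0 => q0.
    by apply/eqP; move/eqP: eq_d; rewrite q0 mul0r eq_sym scale_poly_eq0 (negPf d_neq0).
  - by rewrite coprimepZl // coprimepZr // coprimep_div_gcd // b_neq0 orbT.
  rewrite -!mul_polyC in eq_c eq_d *.
  apply: (mulIf g_neq0).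
  combine (add_eqn (scale_eqn (c%:P * dx P) eq_d) (scale_eqn (- d%:P * dy P) eq_c)).
have := burgers_of_quotient qa b_neq0 (burgers tr0 det0).
case/(burgers_coprime q_neq0 co_pq) => q0 [p0] [p1] [def_q def_p eqn0 eqn1].
have q0_neq0 : q0 != 0 by move: q_neq0; rewrite def_q polyC_eq0.
rewrite {}def_q {}def_p in qa.
have [p1_eq0 | p1_neq0] := eqVneq p1 0.
  exists (lead_coef q0); first by rewrite lead_coef_eq0.
  exists (lead_coef p0).
  have wr : p0^`() * q0 = p0 * q0^`().
    by rewrite p1_eq0 in eqn0; combine (scale_eqn 1 eqn0).
  have prop := congr1 polyC (proportional_of_wronskian q0_neq0 wr).
  rewrite -!mul_polyC !polyCM in prop.
  apply: (@mulfI _ q0%:P); first by rewrite polyC_eq0.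
  rewrite p1_eq0 in qa.
  combine (add_eqn (scale_eqn (lead_coef q0)%:P%:P qa) (scale_eqn (dy P) prop)).
have wr0 : p0^`() * p1 = p0 * p1^`().
  apply: (mulIf q0_neq0).
  combine (add_eqn (scale_eqn p1 eqn0) (scale_eqn (- p0) eqn1)).
have wr1 : (q0 + 'X * p1)^`() * p1 = (q0 + 'X * p1) * p1^`().
  rewrite derivD derivM derivX.
  combine (scale_eqn (-1) eqn1).
have prop0 := congr1 polyC (proportional_of_wronskian p1_neq0 wr0).
have prop1 := congr1 polyC (proportional_of_wronskian p1_neq0 wr1).
set c := lead_coef p0 in prop0; set a := lead_coef (_ + _) in prop1.
have b0 : lead_coef p1 != 0 by rewrite lead_coef_eq0.
set b := lead_coef p1 in prop0 prop1 b0.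
case/eqP: b_neq0; apply: (@deriv_eq0_of_radial P a b c) => //.
rewrite -!mul_polyC !(polyCM, polyCD) in prop0 prop1.
rewrite !(polyCB, polyCM).
apply: (@mulfI _ p1%:P); first by rewrite polyC_eq0.
combine (add_eqn (add_eqn (scale_eqn b%:P%:P qa) (scale_eqn (dy P) prop0))
          (scale_eqn (- dx P) prop1)).
Qed.

End ConstantSlope.

(** * Nilpotent matrices of order three *)

Section NilpotentMatrix3.

Lemma det_mx33 (R : comNzRingType) (M : 'M[R]_3) :
  \det M = M ix ix * (M iy iy * M iz iz - M iy iz * M iz iy)
         - M ix iy * (M iy ix * M iz iz - M iy iz * M iz ix)
         + M ix iz * (M iy ix * M iz iy - M iy iy * M iz ix).
Proof.
pose f a b := M (inord a) (inord b).
have Mf i j : M i j = f i j by rewrite /f !inord_val.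
rewrite (expand_det_row M ix) !big_ord_recl big_ord0 /cofactor.
rewrite !(expand_det_row _ ord0) !big_ord_recl !big_ord0 /cofactor !det_mx11 !mxE.
rewrite !Mf /= /bump /= !(addn0, add0n, addn1).
ring.
Qed.

(** If M is nilpotent, 1 + X M is invertible over R[X], so its determinant is a unit of
    R[X], that is, a constant. The three quantities are its coefficients at X, X^2
    and X^3. *)
Lemma nilpotent_mx33 (R : idomainType) (M : 'M[R]_3) :
    nilpotent_mx M ->
  [/\ M ix ix + M iy iy + M iz iz = 0,
      M ix ix * M iy iy - M ix iy * M iy ix + (M ix ix * M iz iz - M ix iz * M iz ix)
        + (M iy iy * M iz iz - M iy iz * M iz iy) = 0 &
      \det M = 0].
Proof.
case=> k Mk0.
pose N : 'M[{poly R}]_3 := 'X *: map_mx polyC M.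
have Nk0 : (- N) ^+ k = 0.
  by rewrite exprNn exprZn -rmorphXn Mk0 rmorph0 scaler0 mulr0.
have : \det (1 + N) \is a GRing.unit.
  apply/unitrPr; exists (\det (\sum_(i < k) (- N) ^+ i)).
  have := subrX1 (- N) k.
  rewrite Nk0 sub0r -opprD mulNr => /oppr_inj /esym.
  by rewrite addrC -mulmxE -det_mulmx => ->; rewrite det1.
rewrite poly_unitE => /andP[/eqP size1 _].
set t := (X in [/\ X = _, _ & _]); set m := (X in [/\ _, X = _ & _]).
have det1N : \det (1 + N) = 1 + t%:P * 'X + m%:P * 'X ^+ 2 + (\det M)%:P * 'X ^+ 3.
  rewrite !det_mx33 /N !mxE /= /t /m !(polyCD, polyCB, polyCM, polyCN).
  by rewrite !mulr1n !mulr0n; ring.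
have coef_gt0 i : (0 < i)%N -> (\det (1 + N))`_i = 0.
  by move=> i_gt0; rewrite nth_default // size1.
by split; [have := coef_gt0 1%N isT | have := coef_gt0 2%N isT | have := coef_gt0 3%N isT];
   rewrite det1N !(coefD, coefCM, coefX, coefXn, coef1) /=
           !(mulr0, mulr1, addr0, add0r).
Qed.

End NilpotentMatrix3.

(** * Morphisms out of multivariate polynomials *)

Section ChainRule.

Lemma mpoly_ring_ind n (R : nzRingType) (P : {mpoly R[n]} -> Prop) :
    (forall c, P c%:MP) -> (forall i, P 'X_i) ->
    (forall p q, P p -> P q -> P (p + q)) ->
    (forall p q, P p -> P q -> P (p * q)) ->
  forall p, P p.
Proof.
move=> PC PX PD PM; elim/mpolyind => [|c m p _ _ Pp]; first by rewrite -mpolyC0.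
apply: PD => //; rewrite -mul_mpolyC mpolyXE_id; apply: (PM) => //.
elim/big_ind: _ => // [|i _]; first by rewrite -mpolyC1.
by elim: (m i) => [|j IH]; rewrite ?expr0 -?mpolyC1 // exprS; apply: PM.
Qed.

Lemma mpoly_morph_eq n (R S : nzRingType) (f g : {rmorphism {mpoly R[n]} -> S}) :
  (forall c, f c%:MP = g c%:MP) -> (forall i, f 'X_i = g 'X_i) -> f =1 g.
Proof.
move=> eqC eqX; elim/mpoly_ring_ind => // p q eq_p eq_q.
  by rewrite !rmorphD eq_p eq_q.
by rewrite !rmorphM eq_p eq_q.
Qed.

Lemma chain_rule n (R S : comNzRingType) (phi : {rmorphism {mpoly R[n]} -> S})
    (D : {additive S -> S}) (DM : forall a b, D (a * b) = D a * b + a * D b) :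
  (forall c, D (phi c%:MP) = 0) ->
  forall p, D (phi p) = \sum_i phi p^`M(i) * D (phi 'X_i).
Proof.
move=> DC; elim/mpoly_ring_ind => [c|j|p q IHp IHq|p q IHp IHq].
- by rewrite DC big1 // => i _; rewrite mderivC rmorph0 mul0r.
- rewrite (bigD1 j) //= big1 => [|i ne_ij].
    rewrite mderivX mnm1E eqxx scale1r addr0 -[X in (X - _)%MM]add0m addmK mpolyX0.
    by rewrite rmorph1 mul1r.
  by rewrite mderivX mnm1E eq_sym (negPf ne_ij) scale0r rmorph0 mul0r.
- rewrite rmorphD raddfD IHp IHq -big_split /=; apply: eq_bigr => i _.
  by rewrite mderivD rmorphD mulrDl.
rewrite rmorphM DM IHp IHq mulr_suml mulr_sumr -big_split /=.
by apply: eq_bigr => i _; rewrite mderivM rmorphD !rmorphM /=; ring.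
Qed.

End ChainRule.

(** * Three variables as iterated univariate polynomials *)

(** For an ordering a, b, c of the variables, [iterated] is the isomorphism with
    K[a][b][c]: a is the innermost variable and c the outermost one. The order
    (x, y, z) serves to compare powers of z, and (z, x, y) to work over K[z]. *)
Section IteratedPolynomials.
Variable K : fieldType.
Variables a b c : 'I_3.
Hypothesis abc : uniq [:: a; b; c].

Definition iterated_var (i : 'I_3) : {poly {poly {poly K}}} :=
  if i == a then 'X%:P%:P else if i == b then 'X%:P else 'X.

Definition iterated : {mpoly K[3]} -> {poly {poly {poly K}}} :=
  mmap (polyC \o polyC \o polyC) iterated_var.

HB.instance Definition _ := GRing.RMorphism.on iterated.

Lemma mem_abc i : i \in [:: a; b; c].
Proof.
have eq_card : #|[:: a; b; c]| = #|'I_3| by rewrite (card_uniqP abc) card_ord.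
by rewrite (elimT (subset_cardP eq_card)) //; apply/subsetP.
Qed.

Lemma big_abc (R : Type) (idx : R) (op : Monoid.com_law idx) (F : 'I_3 -> R) :
  \big[op/idx]_i F i = op (op (F a) (F b)) (F c).
Proof.
rewrite (perm_big [:: a; b; c]).
  by rewrite !big_cons big_nil /= Monoid.mulm1 Monoid.mulmA.
by apply: uniq_perm => [||i]; rewrite ?index_enum_uniq // mem_index_enum mem_abc.
Qed.

Lemma iteratedD : {morph iterated : p q / p + q}. Proof. exact: rmorphD. Qed.
Lemma iteratedM : {morph iterated : p q / p * q}. Proof. exact: rmorphM. Qed.

Lemma sum_abc (R : nmodType) (F : 'I_3 -> R) : \sum_i F i = F a + F b + F c.
Proof. exact: big_abc. Qed.

Lemma iterated_varE :
  (iterated_var a = 'X%:P%:P) * (iterated_var b = 'X%:P) * (iterated_var c = 'X).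
Proof.
rewrite /iterated_var eqxx.
move: (abc); rewrite /= !inE negb_or => /andP[/andP[ab ac] /andP[bc _]].
by rewrite !(eq_sym b a) !(eq_sym c) (negPf ab) (negPf ac) !eqxx (negPf bc).
Qed.

Lemma iteratedX i : iterated 'X_i = iterated_var i.
Proof. by rewrite /iterated mmapX mmap1U. Qed.

Lemma iteratedC x : iterated x%:MP = x%:P%:P%:P.
Proof. by rewrite /iterated mmapC. Qed.

Lemma iteratedZ x p : iterated (x *: p) = x%:P%:P%:P * iterated p.
Proof. by rewrite /iterated mmapZ. Qed.

Lemma coef_iteratedX (m m' : 'X_{1..3}) :
  (iterated 'X_[m'])`_(m c)`_(m b)`_(m a) = (m' == m)%:R.
Proof.
rewrite /iterated mmapX /mmap1 big_abc /= !iterated_varE -!polyC_exp -mulrA !coefCM coefXn.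
have -> : (m' == m) = [&& m c == m' c, m b == m' b & m a == m' a].
  apply/eqP/and3P => [->|[/eqP eq_c /eqP eq_b /eqP eq_a]]; first by rewrite !eqxx.
  apply/mnmP => i; have := mem_abc i; rewrite !inE.
  by case/or3P=> /eqP->; rewrite (eq_a, eq_b, eq_c).
case: eqP => _ /=; last by rewrite !(mulr0, coef0).
rewrite mulr1 coefXn.
case: eqP => _ /=; last by rewrite !(mulr0, coef0).
by rewrite mulr1 coefXn.
Qed.

Lemma coef_iterated (p : {mpoly K[3]}) (m : 'X_{1..3}) :
  (iterated p)`_(m c)`_(m b)`_(m a) = p@_m.
Proof.
elim/mpolyind: p => [|x m' p _ _ IH].
  by rewrite [iterated 0]rmorph0 !coef0 mcoeff0.
rewrite iteratedD iteratedZ mcoeffD mcoeffZ mcoeffX -IH -(coef_iteratedX m m').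
by move: (iterated _) (iterated _) => P Q; rewrite !coefD !coefCM.
Qed.

Lemma iterated_inj : injective iterated.
Proof. by move=> p q eq_pq; apply/mpolyP=> m; rewrite -!coef_iterated eq_pq. Qed.

(** The values of [D] on the variables are 0 or 1 in all uses, where [D] is a partial
    derivative; encoding them as booleans turns the products into [*+]. *)
Lemma iterated_chain_rule
    (D : {additive {poly {poly {poly K}}} -> {poly {poly {poly K}}}})
    (DM : forall P Q, D (P * Q) = D P * Q + P * D Q) (da db dc : bool) :
    (forall x : K, D x%:P%:P%:P = 0) ->
    D 'X%:P%:P = da%:R -> D 'X%:P = db%:R -> D 'X = dc%:R ->
  forall p, D (iterated p) =
    iterated p^`M(a) *+ da + iterated p^`M(b) *+ db + iterated p^`M(c) *+ dc.
Proof.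
move=> DC Da Db Dc p.
have DC' x : D (iterated x%:MP) = 0 by rewrite iteratedC DC.
have eqD : D (iterated p) = \sum_i iterated p^`M(i) * D (iterated 'X_i) :=
  chain_rule DM DC' p.
by rewrite eqD sum_abc !iteratedX !iterated_varE Da Db Dc !mulr_natr.
Qed.

Lemma iterated_mderiv_a p :
  iterated p^`M(a) = map_poly (map_poly (@deriv K)) (iterated p).
Proof.
have DM := map_polyM_derivation (@derivM K).
rewrite (@iterated_chain_rule _ (map_polyM_derivation DM) true false false).
- by rewrite !mulr0n !addr0.
- by move=> x; rewrite /= !map_polyC /= ?map_polyC /= derivC !polyC0.
- by rewrite /= !map_polyC /= ?map_polyC /= derivX.
- by rewrite /= map_polyC /= (map_polyX_derivation (@derivM K)).
exact: (map_polyX_derivation DM).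
Qed.

Lemma iterated_mderiv_b p : iterated p^`M(b) = map_poly (@deriv {poly K}) (iterated p).
Proof.
have DM := @derivM {poly K}.
rewrite (@iterated_chain_rule _ (map_polyM_derivation DM) false true false).
- by rewrite !mulr0n addr0 add0r.
- by move=> x; rewrite /= map_polyC /= derivC.
- by rewrite /= map_polyC /= derivC.
- by rewrite /= map_polyC /= derivX.
exact: (map_polyX_derivation DM).
Qed.

Lemma iterated_mderiv_c p : iterated p^`M(c) = (iterated p)^`().
Proof.
rewrite (@iterated_chain_rule _ (@derivM {poly {poly K}}) false false true).
- by rewrite !mulr0n !add0r.
- by move=> x; exact: derivC.
- exact: derivC.
- exact: derivC.
exact: derivX.
Qed.

Lemma mdegvar_iterated p : mdegvar c p = (size (iterated p)).-1.
Proof.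
apply/eqP; rewrite eqn_leq; apply/andP; split.
  apply/bigmax_leqP_seq => m; rewrite mcoeff_msupp -coef_iterated => nz _.
  have : (m c < size (iterated p))%N.
    by rewrite ltnNge; apply: contra nz => le; rewrite (nth_default _ le) !coef0.
  by case: (size (iterated p)).
suff : (size (iterated p) <= (mdegvar c p).+1)%N by case: (size (iterated p)).
apply/leq_sizeP => k le_k; apply/polyP => j; apply/polyP => i; rewrite !coef0.
pose m : 'X_{1..3} := [multinom (if l == a then i else if l == b then j else k) | l < 3].
have [ma mb mc] : [/\ m a = i, m b = j & m c = k].
  move: (abc); rewrite /= !inE negb_or => /andP[/andP[ab ac] /andP[bc _]].
  rewrite !mnmE eqxx !(eq_sym b a) !(eq_sym c) (negPf ab) (negPf ac) (negPf bc) eqxx.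
  by [].
rewrite -[in LHS]ma -[in LHS]mb -[in LHS]mc coef_iterated; apply/eqP.
rewrite mcoeff_eq0; apply/negP => m_supp.
by move: le_k; rewrite -mc ltnNge (@leq_bigmax_seq _ _ _ (fun m : 'X_{1..3} => m c)).
Qed.

End IteratedPolynomials.

(** * The gradient of the third component *)

Section Transfer.
Variable K : fieldType.
Hypothesis char0 : [pchar K] =i pred0.
Implicit Types (p u v g : {mpoly K[3]}) (a : {poly K}).

HB.instance Definition _ :=
  GRing.RMorphism.copy (@in_z K) (horner_alg ('X_iz : {mpoly K[3]})).

Lemma in_zC c : @in_z K c%:P = c%:MP.
Proof. by rewrite /in_z horner_algC -mul_mpolyC mulr1. Qed.

Lemma in_zX : @in_z K 'X = 'X_iz.
Proof. exact: horner_algX. Qed.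

Lemma in_zD : {morph @in_z K : a b / a + b}. Proof. exact: rmorphD. Qed.
Lemma in_zM : {morph @in_z K : a b / a * b}. Proof. exact: rmorphM. Qed.

Lemma iterated_in_z a : iterated iz ix (in_z a) = a%:P%:P.
Proof.
elim/poly_ind: a => [|a c IH]; first by rewrite [in_z 0]rmorph0 [LHS]rmorph0 !polyC0.
rewrite in_zD in_zM in_zC in_zX.
by rewrite iteratedD iteratedM IH iteratedC iteratedX /iterated_var /= !polyCD !polyCM.
Qed.

Lemma mderiv_iz_mwiden (h : {mpoly K[2]}) : (mwiden h)^`M(iz) = 0.
Proof.
elim/mpoly_ring_ind: h => [c|i|p q IHp IHq|p q IHp IHq].
- by rewrite mwidenC mderivC.
- rewrite mwidenX mderivX; have -> : mnmwiden U_(i) iz = 0%N.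
    by rewrite (_ : iz = ord_max) ?mnmwiden_ordmax //; apply: val_inj.
  by rewrite scale0r.
- by rewrite mwidenD mderivD IHp IHq addr0.
by rewrite mwidenM mderivM IHp IHq mul0r mulr0 addr0.
Qed.

Lemma third_component_gradient u v g :
    mdegvar iz v = 1%N -> (2 <= mdegvar iz u)%N -> g^`M(iz) = 0 ->
    u^`M(ix) + v^`M(iy) = 0 ->
    u^`M(ix) * v^`M(iy) - u^`M(iy) * v^`M(ix) - u^`M(iz) * g^`M(ix)
      - v^`M(iz) * g^`M(iy) = 0 ->
    g^`M(ix) * (u^`M(iy) * v^`M(iz) - u^`M(iz) * v^`M(iy))
      - g^`M(iy) * (u^`M(ix) * v^`M(iz) - u^`M(iz) * v^`M(ix)) = 0 ->
  g^`M(ix) = 0 /\ g^`M(iy) = 0.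
Proof.
have xyz : uniq [:: ix; iy; iz] by [].
move=> degv degu gz tr mi de.
pose phi := @iterated K ix iy.
have phi0 : phi 0 = 0 by exact: rmorph0.
have def_g : phi g = ((phi g)`_0)%:P.
  apply: size1_polyC; rewrite -(deriv_eq0 (pchar0_poly (pchar0_poly char0))).
  by rewrite -(iterated_mderiv_c xyz) gz [iterated _ _ _]phi0.
have phi_ix p : phi p^`M(ix) = map_poly (map_poly (@deriv K)) (phi p).
  exact: (iterated_mderiv_a xyz).
have phi_iy p : phi p^`M(iy) = map_poly (@deriv {poly K}) (phi p).
  exact: (iterated_mderiv_b xyz).
have phi_iz p : phi p^`M(iz) = (phi p)^`().
  exact: (iterated_mderiv_c xyz).
have phiB p q : phi (p - q) = phi p - phi q by exact: rmorphB.
have phiD p q : phi (p + q) = phi p + phi q by exact: rmorphD.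
have phiM p q : phi (p * q) = phi p * phi q by exact: rmorphM.
have gx : phi g^`M(ix) = (map_poly (@deriv K) (phi g)`_0)%:P.
  by rewrite phi_ix def_g map_polyC coefC.
have gy : phi g^`M(iy) = ((phi g)`_0)^`()%:P.
  by rewrite phi_iy def_g map_polyC coefC.
have [gx0 gy0] : map_poly (@deriv K) (phi g)`_0 = 0 /\ ((phi g)`_0)^`() = 0.
  apply: (@third_gradient_eq0_poly _ (map_poly (@deriv K)) (phi u) (phi v)).
  - exact: pchar0_poly.
  - exact: map_polyM_derivation (@derivM K).
  - exact: map_poly_derivation_deriv.
  - by move: degu; rewrite (mdegvar_iterated xyz) -/phi; case: (size (phi u)).
  - move: degv; rewrite (mdegvar_iterated xyz) -/phi.
    by case: (size (phi v)) => // n /= ->.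
  - by have := congr1 phi tr; rewrite phiD phi_ix phi_iy phi0.
  - have := congr1 phi mi.
    by rewrite !(phiB, phiM) gx gy !(phi_ix, phi_iy, phi_iz) phi0.
  have := congr1 phi de.
  by rewrite !(phiB, phiM) gx gy !(phi_ix, phi_iy, phi_iz) phi0.
split; apply: (iterated_inj xyz); rewrite -/phi phi0.
  by rewrite gx gx0.
by rewrite gy gy0.
Qed.

End Transfer.

(** * The direction along which u and v are constant *)

Section ReducedForm.
Variable K : fieldType.
Hypothesis char0 : [pchar K] =i pred0.
Implicit Types (p u v g : {mpoly K[3]}) (a s t : {poly K}).

(** If u_y = 0, then u_x^2 = 0 and the direction is (0, -1). Otherwise the relation for u
    comes from [constant_slope] over K[z], divided by a gcd, and the one for v from
    the zero determinant and the zero trace. *)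
Lemma planar_slope u v :
    u^`M(ix) + v^`M(iy) = 0 ->
    u^`M(ix) * v^`M(iy) - u^`M(iy) * v^`M(ix) = 0 ->
  exists a1 a2 s t, [/\ s * a1 + t * a2 = 1,
    in_z a2 * u^`M(ix) = in_z a1 * u^`M(iy) &
    in_z a2 * v^`M(ix) = in_z a1 * v^`M(iy)].
Proof.
move=> tr de.
have [uy0 | uy_neq0] := eqVneq u^`M(iy) 0.
  have ux0 : u^`M(ix) = 0.
    have sq : u^`M(ix) * u^`M(ix) = 0.
      combine (add_eqn (scale_eqn (u^`M(ix)) tr)
                (add_eqn (scale_eqn (-1) de) (scale_eqn (- v^`M(ix)) uy0))).
    by move/eqP: sq; rewrite mulf_eq0 orbb => /eqP.
  exists 1, 0, 1, 0; rewrite mulr1 mulr0 addr0 [in_z 0]rmorph0 [in_z 1]rmorph1; split=> //.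
    by rewrite uy0 !mul0r mulr0.
  by combine (add_eqn (scale_eqn (-1) tr) (scale_eqn 1 ux0)).
have zxy : uniq [:: iz; ix; iy] by [].
pose psi := @iterated K iz ix.
have psiD p q : psi (p + q) = psi p + psi q by exact: rmorphD.
have psiB p q : psi (p - q) = psi p - psi q by exact: rmorphB.
have psiM p q : psi (p * q) = psi p * psi q by exact: rmorphM.
have psi0 : psi 0 = 0 by exact: rmorph0.
have psi_ix p : psi p^`M(ix) = map_poly (@deriv {poly K}) (psi p).
  exact: (iterated_mderiv_b zxy).
have psi_iy p : psi p^`M(iy) = (psi p)^`() by exact: (iterated_mderiv_c zxy).
have [al al_neq0 [be slope]] :
    exists2 al, al != 0 & exists be, in_z al * u^`M(ix) = in_z be * u^`M(iy).
  have [|||| al al_neq0 [be slope]] := @constant_slope {poly K} _ (psi u) (psi v).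
  - exact: pchar0_poly.
  - by apply/eqP; rewrite -psi_ix -psi_iy -addr_eq0 -psiD tr psi0.
  - by apply/eqP; rewrite -!psi_ix -!psi_iy -subr_eq0 -!psiM -psiB de psi0.
  - by rewrite -psi_iy -psi0 (inj_eq (iterated_inj zxy)).
  exists al => //; exists be; apply: (iterated_inj zxy).
  by rewrite !iteratedM !iterated_in_z -/psi psi_ix psi_iy.
have in_z_neq0 a : a != 0 -> in_z a != 0.
  apply: contra_neq => /(congr1 psi); rewrite /psi iterated_in_z -/psi psi0.
  by move/eqP; rewrite !polyC_eq0 => /eqP.
pose d := gcdp al be.
have d_neq0 : d != 0 by rewrite gcdp_eq0 (negPf al_neq0).
have def_al : al %/ d * d = al by rewrite divpK // dvdp_gcdl.
have def_be : be %/ d * d = be by rewrite divpK // dvdp_gcdr.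
have : coprimep (be %/ d) (al %/ d).
  by rewrite coprimep_sym coprimep_div_gcd // al_neq0.
case/Bezout_eq1_coprimepP=> [[s t] /= bezout].
exists (be %/ d), (al %/ d), s, t.
have slope_u : in_z (al %/ d) * u^`M(ix) = in_z (be %/ d) * u^`M(iy).
  apply: (mulfI (in_z_neq0 _ d_neq0)).
  by rewrite !mulrA -!in_zM ![d * _]mulrC def_al def_be.
split=> //; apply: (mulfI uy_neq0).
combine (add_eqn (scale_eqn (v^`M(iy)) slope_u) (scale_eqn (- in_z (al %/ d)) de)).
Qed.

End ReducedForm.

(** * Polynomials constant in one direction *)

Section Restriction.
Variable K : fieldType.
Implicit Types (p q : {mpoly K[3]}) (a s t : {poly K}).

Lemma deriv_linear (R : comNzRingType) (r : R) : (r%:P * 'X)^`() = r%:P.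
Proof. by rewrite mul_polyC derivZ derivX -mul_polyC mulr1. Qed.

Lemma deriv_affine (R : comNzRingType) (c r : R) : (c%:P + r%:P * 'X)^`() = r%:P.
Proof. by rewrite derivD derivC add0r deriv_linear. Qed.

Lemma sum3_last0 (R : comNzRingType) (p q r dp dq dr a b : R) :
  dp = a -> dq = b -> dr = 0 -> p * dp + q * dq + r * dr = p * a + q * b.
Proof. by move=> -> -> ->; rewrite mulr0 addr0. Qed.

(** Restriction to the points (s T, t T, z), a line over K[z]; T is the outer variable. *)
Definition restrict_var s t (i : 'I_3) : {poly {poly K}} :=
  if i == ix then s%:P * 'X else if i == iy then t%:P * 'X else 'X%:P.

Definition restrict s t : {mpoly K[3]} -> {poly {poly K}} :=
  mmap (polyC \o polyC) (restrict_var s t).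

HB.instance Definition _ (s t : {poly K}) := GRing.RMorphism.on (restrict s t).

Lemma restrictC s t c : restrict s t c%:MP = c%:P%:P.
Proof. by rewrite /restrict mmapC. Qed.

Lemma restrictX s t i : restrict s t 'X_i = restrict_var s t i.
Proof. by rewrite /restrict mmapX mmap1U. Qed.

(** Translation by a multiple of (a, - b, 0), the multiple being the variable of the
    polynomial ring over K[x,y,z]. *)
Definition shift_var (a b : {mpoly K[3]}) (i : 'I_3) : {poly {mpoly K[3]}} :=
  if i == ix then ('X_ix)%:P + a%:P * 'X
  else if i == iy then ('X_iy)%:P + (- b)%:P * 'X else ('X_iz)%:P.

Definition shift (a b : {mpoly K[3]}) : {mpoly K[3]} -> {poly {mpoly K[3]}} :=
  mmap (polyC \o @mpolyC 3 K) (shift_var a b).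

HB.instance Definition _ (a b : {mpoly K[3]}) := GRing.RMorphism.on (shift a b).

Lemma shiftC (a b : {mpoly K[3]}) c : shift a b c%:MP = c%:MP%:P.
Proof. by rewrite /shift mmapC. Qed.

Lemma shiftX (a b : {mpoly K[3]}) i : shift a b 'X_i = shift_var a b i.
Proof. by rewrite /shift mmapX mmap1U. Qed.

Lemma subst_tM w : {morph (fun f => @subst_t K f w) : f g / f * g}.
Proof. by move=> f g; rewrite /subst_t rmorphM hornerM. Qed.

Lemma subst_tC w a : @subst_t K a%:P w = in_z a.
Proof. by rewrite /subst_t map_polyC hornerC. Qed.

Lemma subst_tX w : @subst_t K 'X w = w.
Proof. by rewrite /subst_t map_polyX hornerX. Qed.

Lemma morph_in_z (S : comNzRingType) (phi : {rmorphism {mpoly K[3]} -> S})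
    (psi : {rmorphism {poly K} -> S}) :
    (forall c, phi c%:MP = psi c%:P) -> phi 'X_iz = psi 'X ->
  forall a, phi (in_z a) = psi a.
Proof.
move=> eqC eqX; elim/poly_ind => [|a c IH]; first by rewrite [in_z 0]rmorph0 !rmorph0.
by rewrite in_zD in_zM in_zC in_zX !rmorphD !rmorphM IH eqX; congr (_ + _).
Qed.

Lemma shift_in_z (a b : {mpoly K[3]}) e : shift a b (in_z e) = (in_z e)%:P.
Proof.
apply: (morph_in_z (phi := shift a b) (psi := polyC \o @in_z K)) => /= [c|].
  by rewrite shiftC in_zC.
by rewrite shiftX in_zX.
Qed.

Lemma restrict_mderiv s t p :
  (restrict s t p)^`() = restrict s t p^`M(ix) * s%:P + restrict s t p^`M(iy) * t%:P.
Proof.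
have DC c : (restrict s t c%:MP)^`() = 0 by rewrite restrictC derivC.
have eqD : (restrict s t p)^`() = \sum_i restrict s t p^`M(i) * (restrict s t 'X_i)^`() :=
  chain_rule (@derivM {poly K}) DC p.
have Dx : (restrict s t 'X_ix)^`() = s%:P by rewrite restrictX; exact: deriv_linear.
have Dy : (restrict s t 'X_iy)^`() = t%:P by rewrite restrictX; exact: deriv_linear.
have Dz : (restrict s t 'X_iz)^`() = 0 by rewrite restrictX; exact: derivC.
by rewrite eqD (@sum_abc ix iy iz isT); exact: (sum3_last0 _ _ _ Dx Dy Dz).
Qed.

Lemma shift_mderiv (a b : {mpoly K[3]}) p :
  (shift a b p)^`() = shift a b p^`M(ix) * a%:P + shift a b p^`M(iy) * (- b)%:P.
Proof.
have DC c : (shift a b c%:MP)^`() = 0 by rewrite shiftC derivC.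
have eqD : (shift a b p)^`() = \sum_i shift a b p^`M(i) * (shift a b 'X_i)^`() :=
  chain_rule (@derivM {mpoly K[3]}) DC p.
have Dx : (shift a b 'X_ix)^`() = a%:P by rewrite shiftX; exact: deriv_affine.
have Dy : (shift a b 'X_iy)^`() = (- b)%:P by rewrite shiftX; exact: deriv_affine.
have Dz : (shift a b 'X_iz)^`() = 0 by rewrite shiftX; exact: derivC.
by rewrite eqD (@sum_abc ix iy iz isT); exact: (sum3_last0 _ _ _ Dx Dy Dz).
Qed.

Lemma pchar0_mpoly n : [pchar K] =i pred0 -> [pchar {mpoly K[n]}] =i pred0.
Proof.
move=> /(pcharf0P K) char0; apply/pcharf0P => m.
by rewrite -(rmorph_nat (@mpolyC n K)) mpolyC_eq0 char0.
Qed.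

(** The polynomial p is constant on lines of direction (a2, - a1). The point
    (s w, t w) lies on such a line through (x, y): it is reached by adding l = s y - t x
    times the direction. So p takes the same value at both points. *)
Lemma subst_restrict (char0 : [pchar K] =i pred0) (a1 a2 s t : {poly K}) p
    (w := in_z a1 * 'X_ix + in_z a2 * 'X_iy) :
    s * a1 + t * a2 = 1 ->
    in_z a2 * p^`M(ix) = in_z a1 * p^`M(iy) ->
  subst_t (restrict s t p) w = p.
Proof.
move=> bezout dir.
have bezout_z : in_z s * in_z a1 + in_z t * in_z a2 = 1.
  by rewrite -!in_zM -in_zD bezout [in_z 1]rmorph1.
pose phi := shift (in_z a2) (in_z a1).
pose l := in_z s * 'X_iy - in_z t * 'X_ix : {mpoly K[3]}.
have phiM q r : phi (q * r) = phi q * phi r by exact: rmorphM.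
(* The derivative in the shift parameter is the derivative of p in this direction. *)
have phi_const : phi p = ((phi p)`_0)%:P.
  apply: size1_polyC; rewrite -deriv_eq0; last exact: pchar0_mpoly.
  have phi_dir := congr1 phi dir; rewrite !phiM /phi !shift_in_z in phi_dir.
  rewrite shift_mderiv polyCN; move: phi_dir.
  move: (shift _ _ _) (shift _ _ _) => q r phi_dir.
  by rewrite mulrN mulrC phi_dir mulrC subrr.
have vars i : [|| i == ix, i == iy | i == iz].
  by have := @mem_abc ix iy iz isT i; rewrite !inE.
have at0 : horner_eval 0 (phi p) = p.
  apply: (mpoly_morph_eq (f := horner_eval 0 \o phi) (g := idfun)) => [c|i] /=.
    by rewrite /phi shiftC /horner_eval hornerC.
  rewrite /phi shiftX /shift_var /horner_eval.
  by case/or3P: (vars i) => /eqP->; rewrite /= !hornerE.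
have at_l : horner_eval l (phi p) = subst_t (restrict s t p) w.
  apply: (mpoly_morph_eq (f := horner_eval l \o phi)
            (g := horner_eval w \o map_poly (@in_z K) \o restrict s t)) => [c|i] /=.
    by rewrite /phi shiftC restrictC [RHS]subst_tC in_zC /horner_eval hornerC.
  rewrite /phi shiftX restrictX /shift_var /restrict_var /horner_eval.
  case/or3P: (vars i) => /eqP->;
    rewrite /= ?[RHS]subst_tM ?(subst_tC, subst_tX) ?hornerE /= /l /w.
  - combine (scale_eqn (- 'X_ix) bezout_z).
  - combine (scale_eqn (- 'X_iy) bezout_z).
  by rewrite [RHS]subst_tC in_zX.
have at_any r : horner_eval r (phi p) = (phi p)`_0.
  by rewrite {1}phi_const /horner_eval hornerC.
by rewrite -at_l -[RHS]at0 !at_any.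
Qed.

End Restriction.

(** * The theorem *)

Lemma mpoly_const_of_mderiv (K : fieldType) n (p : {mpoly K[n]}) :
  [pchar K] =i pred0 -> (forall i, p^`M(i) = 0) -> p = (p@_0)%:MP.
Proof.
move=> char0 p'0; apply/mpolyP => m; rewrite mcoeffC.
have [-> | m_neq0] := eqVneq m 0%MM; first by rewrite mulr1.
rewrite mulr0.
have [i mi_gt0] : exists i, (0 < m i)%N.
  apply/existsP; apply: contraR m_neq0 => /existsPn m0.
  by apply/eqP/mnmP => i; rewrite mnm0E; apply/eqP; rewrite -leqn0 leqNgt m0.
have := mcoeff_deriv i (m - U_(i))%MM p.
rewrite p'0 mcoeff0 submK; last by rewrite lep1mP -lt0n.
by move/esym/eqP; rewrite mulrSn_eq0 // => /eqP.
Qed.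

Lemma mderiv_in_z (K : fieldType) (a : {poly K}) i : i != iz -> (in_z a)^`M(i) = 0.
Proof.
move=> i_neq_z; elim/poly_ind: a => [|a c IH]; first by rewrite [in_z 0]rmorph0 mderiv0.
rewrite in_zD in_zM in_zC in_zX mderivD mderivC addr0 mderivM IH mul0r add0r.
by rewrite mderivX mnm1E eq_sym (negPf i_neq_z) scale0r mulr0.
Qed.

Lemma linmap1 (K : fieldType) n : linmap 1%:M = [tuple 'X_i | i < n] :> polymap K n.
Proof.
apply: eq_from_tnth => i; rewrite !tnth_mktuple (bigD1 i) //= big1 => [|j ne_ji].
  by rewrite mxE eqxx scale1r addr0.
by rewrite mxE eq_sym (negPf ne_ji) scale0r.
Qed.

Lemma pmcomp_linmap1 (K : fieldType) n (H : polymap K n) :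
  pmcomp (linmap (invmx 1%:M)) (pmcomp H (linmap 1%:M)) = H.
Proof.
rewrite invmx1 linmap1.
have -> : pmcomp H [tuple 'X_i | i < n] = H.
  by apply: eq_from_tnth => i; rewrite tnth_mktuple comp_mpoly_id.
by apply: eq_from_tnth => i; rewrite !tnth_mktuple comp_mpolyXU -tnth_nth.
Qed.

Theorem proposition2p4 (K : fieldType) (charK : [pchar K] =i pred0)
    (u v : {mpoly K[3]}) (h : {mpoly K[2]}) (H : polymap K 3)
    (defH : H = [tuple u; v; mwiden h])
    (degv : mdegvar iz v = 1%N)
    (H0 : forall i : 'I_3, (tnth H i).@[fun _ => 0] = 0)
    (degu : (2 <= mdegvar iz u)%N)
    (nilJH : nilpotent_mx (jacobian H)) :
  exists T : 'M[K]_3, T \in unitmx /\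
    exists (a1 a2 c1 c2 : {poly K}) (f : {poly {poly K}}),
      let w := in_z a1 * 'X_ix + in_z a2 * 'X_iy in
      pmcomp (linmap (invmx T)) (pmcomp H (linmap T)) =
      [tuple in_z a2 * subst_t f w + in_z c1;
             - (in_z a1 * subst_t f w) + in_z c2;
             0].
Proof.
have Hx : tnth H ix = u by rewrite defH.
have Hy : tnth H iy = v by rewrite defH.
have Hz : tnth H iz = mwiden h by rewrite defH.
have gz := mderiv_iz_mwiden h.
have [tr mi de] := nilpotent_mx33 nilJH.
rewrite det_mx33 in de; rewrite !mxE Hx Hy Hz gz in tr mi de.
set g := mwiden h in Hz gz mi de.
have [gx gy] : g^`M(ix) = 0 /\ g^`M(iy) = 0.
  apply: (third_component_gradient charK degv degu gz).
  - by rewrite addr0 in tr.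
  - by combine (scale_eqn 1 mi).
  by combine (scale_eqn 1 de).
have tr0 : u^`M(ix) + v^`M(iy) = 0 by rewrite addr0 in tr.
have g0 : g = 0.
  have g_const : g = (g@_0)%:MP.
    apply: mpoly_const_of_mderiv => // i.
    by have := @mem_abc ix iy iz isT i; rewrite !inE => /or3P[] /eqP->.
  by have := H0 iz; rewrite Hz g_const mevalC => ->.
have de0 : u^`M(ix) * v^`M(iy) - u^`M(iy) * v^`M(ix) = 0.
  combine (add_eqn (scale_eqn 1 mi)
            (add_eqn (scale_eqn (u^`M(iz)) gx) (scale_eqn (v^`M(iz)) gy))).
have [a1 [a2 [s [t [bezout slope_u slope_v]]]]] := planar_slope charK tr0 de0.
exists 1%:M; split; first exact: unitmx1.
have subst_u := subst_restrict charK bezout slope_u.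
have subst_v := subst_restrict charK bezout slope_v.
set w := in_z a1 * _ + _ in subst_u subst_v.
have [e def_e] : exists e, in_z a1 * u + in_z a2 * v = in_z e.
  set r := in_z a1 * u + in_z a2 * v.
  have rx : r^`M(ix) = 0.
    rewrite mderivD !mderivM !mderiv_in_z // !mul0r !add0r slope_v -mulrDr tr0.
    by rewrite mulr0.
  have ry : r^`M(iy) = 0.
    rewrite mderivD !mderivM !mderiv_in_z // !mul0r !add0r -slope_u -mulrDr tr0.
    by rewrite mulr0.
  have slope_r : in_z a2 * r^`M(ix) = in_z a1 * r^`M(iy) by rewrite rx ry !mulr0.
  have restrict0 : restrict s t 0 = 0 by exact: rmorph0.
  have restrict_r : restrict s t r = ((restrict s t r)`_0)%:P.
    apply: size1_polyC; rewrite -deriv_eq0; last exact: pchar0_poly.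
    by rewrite restrict_mderiv rx ry restrict0 !mul0r addr0.
  exists (restrict s t r)`_0.
  by rewrite -[LHS](subst_restrict charK bezout slope_r) {1}restrict_r subst_tC.
exists a1, a2, (s * e), (t * e), (t%:P * restrict s t u - s%:P * restrict s t v).
rewrite -/w /= pmcomp_linmap1 defH -/g g0.
have substB f1 f2 : subst_t (f1 - f2) w = subst_t f1 w - subst_t f2 w.
  by rewrite /subst_t rmorphB hornerD hornerN.
have bezout_z : in_z s * in_z a1 + in_z t * in_z a2 = 1.
  by rewrite -!in_zM -in_zD bezout [in_z 1]rmorph1.
rewrite substB !subst_tM !subst_tC subst_u subst_v !in_zM -def_e.
congr [tuple _; _; _].
  combine (scale_eqn (- u) bezout_z).
combine (scale_eqn (- v) bezout_z).
Qed.
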